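(* Let $A\in\mathbb{R}^{n\times n}$ satisfy $\operatorname{Re}(z^*Az)\ge 0$ for all $z\in\mathbb{C}^n$, let $g,v\in\mathbb{R}^n$, $g\neq0$, and let $0<t<\infty$. Let the RT (residual-time) restarted Krylov subspace method be used to compute an approximation to the solution $y(t)$ of the initial-value problem $$y'(s)=-Ay(s)+g,\qquad y(0)=v,$$ on the time interval $[0,t]$, and let $\mathtt{tol}>0$ be the residual tolerance used at each restart. Then for any restart length $k_{\max}\ge1$ the RT restarted Krylov subspace method stops after a finite number $J$ of restarts, and the error of its approximate solution $y_k(t)$ is bounded by $t\cdot\mathtt{tol}$: $$\|y(t)-y_k(t)\|\le t\cdot\mathtt{tol},$$ where $t$ is the length of the whole time interval on which the problem is solved.
   Context: $\|\cdot\|$ is the 2-norm. $\varphi$ is the entire function $\varphi(z)=(e^z-1)/z$ for $z\ne0$, $\varphi(0)=1$, applied to matrices as a matrix function. Arnoldi process for $A$ with starting vector $\tilde g\neq0$: after $k$ steps one has a matrix $V_{k+1}=[v_1,\dots,v_{k+1}]$ with orthonormal columns, $v_1=\tilde g/\|\tilde g\|$, and an upper Hessenberg matrix $\underline{H}_k\in\mathbb{R}^{(k+1)\times k}$ with $AV_k=V_{k+1}\underline{H}_k=V_kH_k+h_{k+1,k}v_{k+1}e_k^T$, where $V_k=[v_1,\dots,v_k]$, $H_k=V_k^TAV_k$ is formed by the first $k$ rows of $\underline{H}_k$, and $h_{k+1,k}\ge0$. RT restarted Krylov subspace method. Keep a current initial vector $v$ and a current remaining time length $\tau$, initially the given $v$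 and $\tau=t$. Repeat the following cycle (''restart''): 1. Set $\tilde g=g-Av$, $\beta=\|\tilde g\|$, and start the Arnoldi process with $v_1=\tilde g/\beta$. (If $\beta=0$, the current $v$ is the exact constant solution on the remaining interval and the method stops, returning $v$.) 2. For $k=1,2,\dots,k_{\max}$, carry out step $k$ of the Arnoldi process. The current Krylov approximation to the solution of the initial-value problem with initial vector $v$ is $$y_k(s)=v+V_k\,s\,\varphi(-sH_k)(\beta e_1),\qquad s\in[0,\tau],$$ and its residual is $r_k(s)=-Ay_k(s)+g-y_k'(s)=-h_{k+1,k}v_{k+1}e_k^T\,s\,\varphi(-sH_k)(\beta e_1)$ (which is identically zero if $h_{k+1,k}=0$). - If $\max_{s\in[0,\tau]}\|r_k(s)\|\le\mathtt{tol}$, the method stops and returns $y_k(\tau)$ as the approximate solution at the final time (denoted $y_k(t)$ in the claim). - Otherwise, if $k=k_{\max}$, find the largest $\delta$ such that $\max_{s\in[0,\delta]}\|r_k(s)\|\le\mathtt{tol}$, replace $v$ by $y_k(\delta)$ and $\tau$ by $\tau-\delta$, and begin a new cycle. *)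

(* Defs.v *)
From HB Require Import structures.
From mathcomp Require Import all_boot all_order all_algebra.
From mathcomp Require Import complex.
From mathcomp Require Import all_classical all_reals all_analysis.
Import Order.TTheory GRing.Theory Num.Theory.
Import numFieldNormedType.Exports.

Set Implicit Arguments.
Unset Strict Implicit.
Unset Printing Implicit Defensive.

Local Open Scope classical_set_scope.
Local Open Scope ring_scope.

Definition dotv (R : realType) (n : nat) (u w : 'cV[R]_n) : R :=
  (u^T *m w) 0 0.

(* The library's `|u| on matrices is the max norm, hence an explicit 2-norm. *)
Definition norm2 (R : realType) (n : nat) (u : 'cV[R]_n) : R :=
  Num.sqrt (dotv u u).

Definition accretive (R : realType) (n : nat) (A : 'M[R]_n) : Prop :=
  forall z : 'cV[R[i]]_n,
    0 <= complex.Re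
           (((map_mx (@conjc R) z)^T *m map_mx (real_complex R) A *m z) 0 0).

Definition phi (R : realType) (x : R) : R :=
  if x == 0 then 1 else (expR x - 1) / x.

(* Taylor coefficients of phi at 0: phi(z) = \sum_k z^k / (k+1)!, so that phi_mx
   below is the matrix function of the entire function phi. *)
Definition phi_coef (R : realType) (k : nat) : R := ((k.+1)`!%:R)^-1.

Lemma cvg_phi_series (R : realType) (x : R) :
  series (fun k => phi_coef R k * x ^+ k) @ \oo --> phi x.
Proof.
rewrite /phi; case: eqVneq => [->|x0].
  apply: (cvg_trans _ (@cvg_cst R 1 nat \oo _)).
  apply: near_eq_cvg; exists 1%N => // -[//|m] _ /=.
  rewrite /series /= big_nat_recl //= big1 => [|i _].
    by rewrite /phi_coef expr0 mulr1 invr1 addr0.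
  by rewrite expr0n mulr0.
have H : series (exp_coeff x) @ \oo --> expR x.
  exact: is_cvg_series_exp_coeff.
rewrite -(cvg_shiftS (series (exp_coeff x))) in H.
have {}H : (fun m => (series (exp_coeff x) m.+1 - 1) * x^-1) @ \oo
    --> (expR x - 1) * x^-1.
  by apply: cvgMr_tmp; apply: cvgB => //; exact: cvg_cst.
apply: cvg_trans H; apply: near_eq_cvg; near=> m.
rewrite /series /= big_nat_recl //= {1}/exp_coeff /= expr0 divr1.
rewrite addrC addrA addNr add0r big_distrl /=.
apply: eq_bigr => i _; rewrite /exp_coeff /phi_coef /= exprSr.
by rewrite mulrAC mulfK // mulrC.
Unshelve. all: by end_near. Qed.

Definition phi_mx (R : realType) (k : nat) (M : 'M[R]_k) : 'M[R]_k :=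
  limn (series (fun j => phi_coef R j *: M ^+ j)).

(* The Arnoldi process by Gram-Schmidt; indices are shifted by one, so that
   arnoldi_basis A b k = [:: v_1; ...; v_(k+1)]. At a breakdown w = 0 and, as
   0^-1 = 0, the process continues with zero vectors; the method below stops
   before using them. *)
Fixpoint arnoldi_basis (R : realType) (n : nat) (A : 'M[R]_n) (b : 'cV[R]_n)
    (k : nat) : seq 'cV[R]_n :=
  if k is k'.+1 then
    let vs := arnoldi_basis A b k' in
    let a := A *m last 0 vs in
    let w := a - \sum_(u <- vs) dotv u a *: u in
    rcons vs ((norm2 w)^-1 *: w)
  else [:: (norm2 b)^-1 *: b].

Definition arnoldi_V (R : realType) (n : nat) (A : 'M[R]_n) (b : 'cV[R]_n)
    (k : nat) : 'M[R]_(n, k) :=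
  \matrix_(i < n, j < k) (last 0 (arnoldi_basis A b j)) i 0.

Definition arnoldi_H (R : realType) (n : nat) (A : 'M[R]_n) (b : 'cV[R]_n)
    (k : nat) : 'M[R]_k :=
  (arnoldi_V A b k)^T *m A *m arnoldi_V A b k.

Definition krylov_approx (R : realType) (n : nat) (A : 'M[R]_n)
    (g v : 'cV[R]_n) (k : nat) (s : R) : 'cV[R]_n :=
  let b := g - A *m v in
  let e1 : 'cV[R]_k := \col_i ((i : nat) == 0%N)%:R in
  v + arnoldi_V A b k
      *m (s *: (phi_mx ((- s) *: arnoldi_H A b k) *m (norm2 b *: e1))).

Definition residual (R : realType) (n : nat) (A : 'M[R]_n) (g : 'cV[R]_n)
    (y : R -> 'cV[R]_n) (s : R) : 'cV[R]_n :=
  - (A *m y s) + g - derive1 y s.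

(* max_(s in [0, d]) ||r_k(s)|| <= tol *)
Definition residual_le (R : realType) (n : nat) (A : 'M[R]_n) (g : 'cV[R]_n)
    (tol : R) (v : 'cV[R]_n) (k : nat) (d : R) : Prop :=
  forall s : R, 0 <= s <= d ->
    norm2 (residual A g (krylov_approx A g v k) s) <= tol.

(* rt_run A g tol kmax v tau J yout: started with the initial vector v and the
   remaining time tau, the method begins J further cycles after the first one,
   then stops and returns yout. *)
Inductive rt_run (R : realType) (n : nat) (A : 'M[R]_n) (g : 'cV[R]_n)
    (tol : R) (kmax : nat) : 'cV[R]_n -> R -> nat -> 'cV[R]_n -> Prop :=
| rt_exact (v : 'cV[R]_n) (tau : R) :
    norm2 (g - A *m v) = 0 ->
    rt_run A g tol kmax v tau 0 v
| rt_stop (v : 'cV[R]_n) (tau : R) (k : nat) :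
    norm2 (g - A *m v) <> 0 ->
    (1 <= k <= kmax)%N ->
    residual_le A g tol v k tau ->
    (forall j : nat, (1 <= j < k)%N -> ~ residual_le A g tol v j tau) ->
    rt_run A g tol kmax v tau 0 (krylov_approx A g v k tau)
| rt_restart (v : 'cV[R]_n) (tau delta : R) (J : nat) (yout : 'cV[R]_n) :
    norm2 (g - A *m v) <> 0 ->
    (forall k : nat, (1 <= k <= kmax)%N -> ~ residual_le A g tol v k tau) ->
    0 <= delta <= tau ->
    residual_le A g tol v kmax delta ->
    (forall d : R, 0 <= d <= tau -> residual_le A g tol v kmax d ->
       d <= delta) ->
    rt_run A g tol kmax (krylov_approx A g v kmax delta) (tau - delta) J yout ->
    rt_run A g tol kmax v tau J.+1 yout.

Definition ivp_solution (R : realType) (n : nat) (A : 'M[R]_n)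
    (g v : 'cV[R]_n) (t : R) (y : R -> 'cV[R]_n) : Prop :=
  [/\ y 0 = v,
      {within `[0, t], continuous y} &
      forall s : R, 0 < s < t -> is_derive s (1 : R) y (- (A *m y s) + g)].

(* Main.v *)
Require Import Defs.
From mathcomp Require Import all_boot all_order all_algebra.
From mathcomp Require Import complex ring lra.
From mathcomp Require Import all_classical all_reals all_analysis.
Import Order.TTheory GRing.Theory Num.Theory.
Import numFieldNormedType.Exports.
Local Open Scope classical_set_scope.
Local Open Scope ring_scope.

(** Accretivity of [A] makes the flow of y' = -A y non-expansive. Hence, if
    e' = -A e + r with [norm2 (r s) <= M], the norm of [e] grows at rate at most
    [M] ([accretive_growth_le]). Both claims rest on this estimate.

    For the error: the difference of the exact solution and a Krylov
    approximation satisfies such an equation, its forcing term being the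
    residual, which is at most [tol] wherever the method uses the approximation.
    Each cycle of length [d] therefore adds at most [d * tol] to the error it
    inherits ([krylov_error_le]), and the lengths of the cycles add up to the
    whole time ([rt_run_error_le]).

    For termination: the Krylov approximation itself satisfies such an equation,
    with forcing term [g] minus the residual, so all the restart vectors remain
    in one ball, whose radius depends only on [v], [g], [t] and [tol]
    ([norm2_krylov_le]). On that ball the residual is at most [C * s] with one
    constant [C] ([residual_linear_bound]). Each cycle that does not stop
    therefore advances the time by at least [tol / C], and this can occur only
    finitely often ([rt_run_exists]).

    The linear bound on the residual comes from an exact formula. Let
    E(s) = s phi(-s H), which is the integral of exp(-u H) over [0, s], so that
    E' = 1 - H E ([is_derive_int_exp]). Because the first Arnoldi vector is the
    normalised initial residual b, one has V (norm2 b e1) = b, and the terms of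
    order 0 in the residual cancel. What is left is
    (V H - A V) E(s) (norm2 b e1) ([residualE]): a factor [s], times quantities
    bounded in terms of the norm of [A], since no entry of V exceeds 1 in
    absolute value. *)

(** * The Euclidean norm and an entrywise matrix norm *)

Section Euclidean.
Set Implicit Arguments.
Unset Strict Implicit.
Context {R : realType}.

Lemma dotvE n (u w : 'cV[R]_n) : dotv u w = \sum_i u i 0 * w i 0.
Proof. by rewrite /dotv mxE; apply: eq_bigr => i _; rewrite mxE. Qed.

Lemma dotvC n (u w : 'cV[R]_n) : dotv u w = dotv w u.
Proof. by rewrite !dotvE; apply: eq_bigr => i _; rewrite mulrC. Qed.

Lemma dotvDr n (u w z : 'cV[R]_n) : dotv u (w + z) = dotv u w + dotv u z.
Proof. by rewrite /dotv mulmxDr mxE. Qed.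

Lemma dotvNr n (u w : 'cV[R]_n) : dotv u (- w) = - dotv u w.
Proof. by rewrite /dotv mulmxN mxE. Qed.

Lemma dotvZr n (a : R) (u w : 'cV[R]_n) : dotv u (a *: w) = a * dotv u w.
Proof. by rewrite /dotv -scalemxAr mxE. Qed.

Lemma dotv_ge0 n (u : 'cV[R]_n) : 0 <= dotv u u.
Proof. by rewrite dotvE sumr_ge0// => i _; rewrite -expr2 sqr_ge0. Qed.

Lemma norm2_ge0 n (u : 'cV[R]_n) : 0 <= norm2 u.
Proof. exact: sqrtr_ge0. Qed.

Lemma sqr_norm2 n (u : 'cV[R]_n) : norm2 u ^+ 2 = dotv u u.
Proof. by rewrite sqr_sqrtr// dotv_ge0. Qed.

Lemma coord_le_norm2 n (u : 'cV[R]_n) i : `|u i 0| <= norm2 u.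
Proof.
rewrite -sqrtr_sqr ler_sqrt ?dotv_ge0// dotvE (bigD1 i)//= -expr2 lerDl.
by apply: sumr_ge0 => j _; rewrite -expr2 sqr_ge0.
Qed.

Lemma norm2_eq0 n (u : 'cV[R]_n) : norm2 u = 0 -> u = 0.
Proof.
move=> u0; apply/colP => i; rewrite mxE.
by apply/eqP; rewrite -normr_le0 (le_trans (coord_le_norm2 _ _))// u0.
Qed.

Lemma norm20 n : norm2 (0 : 'cV[R]_n) = 0.
Proof. by rewrite /norm2 /dotv mulmx0 mxE sqrtr0. Qed.

Lemma norm2N n (u : 'cV[R]_n) : norm2 (- u) = norm2 u.
Proof. by rewrite /norm2 dotvNr dotvC dotvNr opprK. Qed.

(** Both vectors are scaled by the norm of the other one, and the square of the
    difference is expanded. *)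
Lemma cauchy_schwarz n (u w : 'cV[R]_n) : dotv u w <= norm2 u * norm2 w.
Proof.
have [u0|u0] := eqVneq (norm2 u) 0.
  by rewrite (norm2_eq0 u0) dotvC /dotv mulmx0 mxE norm20 mul0r.
have [w0|w0] := eqVneq (norm2 w) 0.
  by rewrite (norm2_eq0 w0) /dotv mulmx0 mxE norm20 mulr0.
have p0 : 0 < norm2 u * norm2 w.
  by rewrite mulr_gt0// lt0r ?u0 ?w0 norm2_ge0.
have := dotv_ge0 (norm2 w *: u - norm2 u *: w).
rewrite dotvDr dotvNr !dotvZr [dotv _ u]dotvC [dotv _ w]dotvC.
rewrite !dotvDr !dotvNr !dotvZr -!sqr_norm2 [dotv w u]dotvC => h.
rewrite -(ler_pM2l p0); nra.
Qed.

Lemma ler_norm2D n (u w : 'cV[R]_n) : norm2 (u + w) <= norm2 u + norm2 w.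
Proof.
rewrite -(@ler_pXn2r _ 2)// ?nnegrE ?addr_ge0 ?norm2_ge0//.
rewrite sqr_norm2 dotvDr ![dotv (u + w) _]dotvC !dotvDr (dotvC w u) -!sqr_norm2.
have := cauchy_schwarz u w; nra.
Qed.

(** The entrywise l1 norm: among the easily computed matrix norms, it is
    submultiplicative for rectangular matrices and dominates [norm2] on columns,
    so products of bounded matrices can be estimated factor by factor. *)
Definition mxl1 m n (X : 'M[R]_(m, n)) : R := \sum_i \sum_j `|X i j|.

Lemma mxl1_ge0 m n (X : 'M[R]_(m, n)) : 0 <= mxl1 X.
Proof. by apply: sumr_ge0 => i _; apply: sumr_ge0. Qed.

Lemma mxl1M m n p (X : 'M[R]_(m, n)) (Y : 'M[R]_(n, p)) :
  mxl1 (X *m Y) <= mxl1 X * mxl1 Y.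
Proof.
rewrite /mxl1 big_distrl/= ler_sum// => i _.
rewrite (@le_trans _ _ (\sum_j \sum_l `|X i l| * `|Y l j|))//.
  by apply: ler_sum => j _; rewrite mxE (le_trans (ler_norm_sum _ _ _))//
    ler_sum// => l _; rewrite normrM.
rewrite exchange_big/= big_distrl/= ler_sum// => l _.
rewrite -big_distrr/= ler_wpM2l// (bigD1 l)//= lerDl.
by apply: sumr_ge0 => ? _; apply: sumr_ge0.
Qed.

Lemma mxl1D m n (X Y : 'M[R]_(m, n)) : mxl1 (X + Y) <= mxl1 X + mxl1 Y.
Proof.
rewrite /mxl1 -big_split/= ler_sum// => i _.
by rewrite -big_split/= ler_sum// => j _; rewrite mxE ler_normD.
Qed.

Lemma mxl1N m n (X : 'M[R]_(m, n)) : mxl1 (- X) = mxl1 X.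
Proof.
by apply: eq_bigr => i _; apply: eq_bigr => j _; rewrite mxE normrN.
Qed.

Lemma mxl1_tr m n (X : 'M[R]_(m, n)) : mxl1 X^T = mxl1 X.
Proof.
rewrite /mxl1 exchange_big; apply: eq_bigr => i _.
by apply: eq_bigr => j _; rewrite mxE.
Qed.

Lemma mxl1Z m n (a : R) (X : 'M[R]_(m, n)) : mxl1 (a *: X) = `|a| * mxl1 X.
Proof.
rewrite /mxl1 big_distrr; apply: eq_bigr => i _ /=.
by rewrite big_distrr; apply: eq_bigr => j _; rewrite mxE normrM.
Qed.

Lemma mxl1_bound m n (X : 'M[R]_(m, n)) (c : R) :
  (forall i j, `|X i j| <= c) -> mxl1 X <= (m * n)%:R * c.
Proof.
move=> Xc; rewrite (@le_trans _ _ (\sum_(i < m) \sum_(j < n) c))//.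
  by apply: ler_sum => i _; apply: ler_sum.
by rewrite !sumr_const !card_ord -mulrnA mulr_natl mulnC.
Qed.

Lemma entry_le_mxl1 m n (X : 'M[R]_(m, n)) i j : `|X i j| <= mxl1 X.
Proof.
rewrite /mxl1 (bigD1 i)//= (bigD1 j)//= -addrA lerDl addr_ge0//.
  exact: sumr_ge0.
by apply: sumr_ge0 => ? _; apply: sumr_ge0.
Qed.

Lemma norm2_le_mxl1 n (u : 'cV[R]_n) : norm2 u <= mxl1 u.
Proof.
rewrite -(@ler_pXn2r _ 2)// ?nnegrE ?norm2_ge0 ?mxl1_ge0//.
rewrite sqr_norm2 dotvE /mxl1 expr2 big_distrl ler_sum// => i _ /=.
rewrite big_ord1 (le_trans (ler_norm _))// normrM ler_wpM2l//.
exact: entry_le_mxl1.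
Qed.

(** On real vectors the Hermitian form reduces to the real bilinear one. *)
Lemma accretive_dotv n (A : 'M[R]_n) (u : 'cV[R]_n) :
  accretive A -> 0 <= dotv u (A *m u).
Proof.
move=> /(_ (map_mx (real_complex R) u)).
have -> : map_mx (@conjc R) (map_mx (real_complex R) u) = map_mx (real_complex R) u.
  by apply/matrixP => i j; rewrite !mxE conjc_real.
by rewrite matrix.map_trmx -!map_mxM mxE/= /dotv mulmxA.
Qed.

End Euclidean.

(** * Calculus of matrix-valued functions and growth of perturbed flows *)

Section MatrixCalculus.
Set Implicit Arguments.
Unset Strict Implicit.
Context {R : realType}.

Lemma is_derive_mxP m n (M : R -> 'M[R]_(m, n)) (s : R) (dM : 'M[R]_(m, n)) :
  is_derive s (1 : R) M dM <->
  forall i j, is_derive s (1 : R) (fun x => M x i j) (dM i j).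
Proof.
split=> [[dM1 <-] i j|H].
  by rewrite derive_mx// mxE; apply: derivableP; exact: (derivable_mxP _ _ _).1.
have dM1 : derivable M s 1 by apply/derivable_mxP => i j; have [] := H i j.
split=> //; rewrite derive_mx//; apply/matrixP => i j; rewrite mxE.
by have [] := H i j.
Qed.

Lemma is_derive_sandwich m n p q (X : 'M[R]_(m, n)) (F : R -> 'M[R]_(n, p))
    (Y : 'M[R]_(p, q)) (s : R) dF :
  is_derive s (1 : R) F dF ->
  is_derive s (1 : R) (fun x => X *m F x *m Y) (X *m dF *m Y).
Proof.
move=> /is_derive_mxP dFij; apply/is_derive_mxP => i j.
rewrite (_ : (fun _ => _) =
    \sum_(l < p) \sum_(h < n) (X i h * Y l j) \*: (fun x => F x h l)); last first.
  apply/funext => x; rewrite mxE fct_sumE; apply: eq_bigr => l _.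
  rewrite mxE fct_sumE big_distrl/=; apply: eq_bigr => h _.
  by rewrite mulrAC.
rewrite mxE (_ : \sum_l _ =
    \sum_(l < p) \sum_(h < n) (X i h * Y l j) *: dF h l); last first.
  apply: eq_bigr => l _.
  by rewrite mxE big_distrl/=; apply: eq_bigr => h _; rewrite mulrAC.
by apply: is_derive_sum => l; apply: is_derive_sum => h.
Qed.

Lemma is_derive_translate m n (F : R -> 'M[R]_(m, n)) (a s : R) dF :
  is_derive (s - a) (1 : R) F dF -> is_derive s (1 : R) (fun x => F (x - a)) dF.
Proof.
move=> /is_derive_mxP dFij; apply/is_derive_mxP => i j.
have da : is_derive s (1 : R) (fun x : R => x - a) 1.
  by apply: is_derive_eq; rewrite subr0.
rewrite -[dF i j]mulr1.
exact: (@is_derive1_comp R (fun x => F x i j) (fun x => x - a) s (dF i j) 1).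
Qed.

Lemma is_derive_continuous m n (F : R -> 'M[R]_(m, n)) (s : R) dF :
  is_derive s (1 : R) F dF -> {for s, continuous F}.
Proof. by move=> [? _]; exact/differentiable_continuous/derivable1_diffP. Qed.

Lemma cvg_mx m n (u : nat -> 'M[R]_(m, n)) (l : 'M[R]_(m, n)) :
  (forall i j, (fun N => u N i j) @ \oo --> l i j) -> u @ \oo --> l.
Proof.
move=> ul; apply/cvgrPdist_le => /= e e0; near=> N.
rewrite /Num.Def.normr/= mx_normrE (bigmax_le _ (ltW e0))//= => ij _.
rewrite !mxE; move: ij; near: N; apply: filter_forall => /= ij.
exact: ((cvgrPdist_le _ _).1 (ul ij.1 ij.2)).
Unshelve. all: by end_near. Qed.

Lemma within_continuous_comp (T U V : topologicalType) (B : set T) (f : T -> U)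
    (h : U -> V) :
  {within B, continuous f} -> continuous h -> {within B, continuous (h \o f)}.
Proof. by move=> fc hc x; exact: (continuous_comp (fc x) (hc (f x))). Qed.

Lemma continuous_dotv n : continuous (fun u : 'cV[R]_n => dotv u u).
Proof.
rewrite (_ : (fun u => _) = fun u : 'cV[R]_n => \sum_i u i 0 * u i 0); last first.
  by apply/funext => u; exact: dotvE.
apply: continuous_big => [|i _]; first exact: add_continuous.
move=> u; apply: (@continuousM _ _ (fun u : 'cV[R]_n => u i 0)
  (fun u : 'cV[R]_n => u i 0)); exact: coord_continuous.
Qed.

Lemma continuous_norm2 n : continuous (@norm2 R n).
Proof.
move=> u; apply: (@continuous_comp _ _ _ (fun u => dotv u u) Num.sqrt).
  exact: continuous_dotv.
exact: sqrt_continuous.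
Qed.

(** Where [e] does not vanish, the derivative of its norm is
    (- <e, A e> + <e, r>) / |e|, which is at most |r| by accretivity and
    Cauchy-Schwarz. The norm is replaced by sqrt (eps^2 + |e|^2), which is
    differentiable also at the zeros of [e] and within [eps] of it. *)
Lemma accretive_growth_le n (A : 'M[R]_n) (e r : R -> 'cV[R]_n) (a b M : R) :
  accretive A -> a <= b -> {within `[a, b], continuous e} ->
  (forall s, a < s < b -> is_derive s (1 : R) e (- (A *m e s) + r s)) ->
  (forall s, a < s < b -> norm2 (r s) <= M) ->
  norm2 (e b) <= norm2 (e a) + (b - a) * M.
Proof.
move=> hA ab ec ed rM.
apply/ler_addgt0Pr => eps eps0.
pose N x := Num.sqrt (eps ^+ 2 + dotv (e x) (e x)).
have NE x : N x ^+ 2 = eps ^+ 2 + norm2 (e x) ^+ 2.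
  by rewrite sqr_norm2 sqr_sqrtr// addr_ge0 ?sqr_ge0 ?dotv_ge0.
have Ngt0 x : 0 < N x.
  by rewrite sqrtr_gt0 ltr_wpDr ?dotv_ge0 ?exprn_gt0.
have eN x : norm2 (e x) <= N x.
  rewrite -(@ler_pXn2r _ 2)// ?nnegrE ?norm2_ge0 ?(ltW (Ngt0 _))// NE.
  by rewrite lerDr sqr_ge0.
have Ne x : N x <= norm2 (e x) + eps.
  rewrite -(@ler_pXn2r _ 2)// ?nnegrE ?addr_ge0 ?norm2_ge0 ?(ltW (Ngt0 _))
    ?(ltW eps0)//.
  by rewrite NE; have := norm2_ge0 (e x); nra.
have dot_sum : (fun x => dotv (e x) (e x)) =
    \sum_i ((fun x => e x i 0) * (fun x => e x i 0)).
  by apply/funext => x; rewrite dotvE fct_sumE.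
have Nc : {within `[a, b], continuous N}.
  have gc : continuous (fun u : 'cV[R]_n => Num.sqrt (eps ^+ 2 + dotv u u)).
    move=> u; apply: continuous_comp; last exact: sqrt_continuous.
    apply: (@continuousD _ _ _ (cst (eps ^+ 2))); first exact: cst_continuous.
    exact: continuous_dotv.
  exact: (within_continuous_comp ec gc).
pose dN s := dotv (e s) (- (A *m e s) + r s) / N s.
have Nd s : s \in `]a, b[ -> is_derive s (1 : R) N (dN s).
  rewrite in_itv/= => sab.
  have /is_derive_mxP dei := ed s sab.
  have dd : is_derive s (1 : R) (fun x => eps ^+ 2 + dotv (e x) (e x))
     (2 * dotv (e s) (- (A *m e s) + r s)).
    rewrite -[X in is_derive _ _ _ X]add0r; apply: is_deriveD.
    rewrite dot_sum dotvE big_distrr/=.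
    apply: is_derive_sum => i.
    have di := dei i 0.
    apply: is_derive_eq => /=.
    by rewrite /GRing.scale/= mulr_natl mulr2n.
  have p0 : 0 < eps ^+ 2 + dotv (e s) (e s).
    by rewrite ltr_wpDr ?dotv_ge0 ?exprn_gt0.
  have := is_derive1_sqrt p0 => ds.
  have dsd := @is_derive1_comp R Num.sqrt
    (fun x => eps ^+ 2 + dotv (e x) (e x)) s _ _ ds dd.
  have dN' : is_derive s (1:R) N _ := dsd.
  apply: (is_derive_eq dN').
  by rewrite /dN -/(N s); field; rewrite gt_eqF.
have dNM s : s \in `]a, b[ -> dN s <= M.
  move=> /[dup] sab; rewrite in_itv/= => sab'.
  rewrite ler_pdivrMr// dotvDr dotvNr.
  have h1 := accretive_dotv (e s) hA.
  have h2 := cauchy_schwarz (e s) (r s).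
  have h3 := rM s sab'.
  have h4 := eN s; have h5 := norm2_ge0 (e s); have h6 := norm2_ge0 (r s).
  have : norm2 (e s) * norm2 (r s) <= N s * M by apply: ler_pM.
  lra.
move: ab; rewrite le_eqVlt => /predU1P[<-|ab].
  by rewrite subrr mul0r addr0 lerDl ltW.
have [c cab] := MVT ab Nd Nc.
have := dNM c cab => h /eqP; rewrite subr_eq => /eqP NbE.
have := eN b; have := Ne a.
have : dN c * (b - a) <= M * (b - a) by rewrite ler_pM2r ?subr_gt0.
lra.
Qed.

End MatrixCalculus.

(** * The matrix function phi and the integral of the exponential *)

Section PhiFunction.
Set Implicit Arguments.
Unset Strict Implicit.
Context {R : realType}.

Lemma pseries_exp_dominated (c : nat -> R) (C b x : R) :
  0 <= b -> (forall m, `|c m| <= C * (b ^+ m / m`!%:R)) ->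
  cvgn (pseries c x) /\ `|limn (pseries c x)| <= C * expR (b * `|x|).
Proof.
move=> b0 cC.
have C0 : 0 <= C by have := cC 0; rewrite expr0 divr1 mulr1; apply: le_trans.
have e0 : 0 <= b * `|x| by rewrite mulr_ge0.
have le_term m : `|c m * x ^+ m| <= C * exp_coeff (b * `|x|) m.
  rewrite normrM normrX /exp_coeff/= exprMn mulrAC [leRHS]mulrA.
  have := cC m => /(ler_wpM2r (exprn_ge0 m (normr_ge0 x))).
  by rewrite !mulrA [leRHS]mulrAC.
have cE : cvgn (series (C *: exp_coeff (b * `|x|))).
  by apply: is_cvg_seriesZ; exact: is_cvg_series_exp_coeff.
have cN : cvgn [normed series (fun m => c m * x ^+ m)].
  apply: (@series_le_cvg _ _ (C *: exp_coeff (b * `|x|))) => //= m.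
    by rewrite mulr_ge0// exp_coeff_ge0.
split; first exact: normed_cvg.
apply: (le_trans (lim_series_norm cN)).
rewrite /expR -[_ * _](lim_seriesZ C (is_cvg_series_exp_coeff _)).
exact: lim_series_le.
Qed.

Lemma expr_entry_le k (B : 'M[R]_k) m i j : `|(B ^+ m) i j| <= mxl1 B ^+ m.
Proof.
elim: m i j => [|m IH] i j.
  by rewrite !expr0 mxE; case: eqP; rewrite ?normr1 ?normr0.
rewrite !exprS mxE (le_trans (ler_norm_sum _ _ _))//.
rewrite (@le_trans _ _ (\sum_l `|B i l| * mxl1 B ^+ m))//.
  by apply: ler_sum => l _; rewrite normrM ler_wpM2l.
rewrite -big_distrl/= ler_wpM2r ?exprn_ge0 ?mxl1_ge0//.
by rewrite /mxl1 [leRHS](bigD1 i)//= lerDl sumr_ge0// => ? _; apply: sumr_ge0.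
Qed.

Lemma exprZ_mx k (B : 'M[R]_k) (s : R) m : (s *: B) ^+ m = s ^+ m *: B ^+ m.
Proof.
elim: m => [|m IH]; first by rewrite !expr0 scale1r.
by rewrite !exprS IH -!mulmxE -scalemxAl -scalemxAr scalerA.
Qed.

Definition phi_entry_coef k (B : 'M[R]_k) i j m : R :=
  phi_coef R m * (B ^+ m) i j.

Lemma inv_fact_le (m : nat) : ((m.+1)`!%:R)^-1 <= (m`!%:R)^-1 :> R.
Proof.
by rewrite lef_pV2 ?posrE ?ltr0n ?fact_gt0// ler_nat factS leq_pmull.
Qed.

Lemma phi_entry_coef_le k (B : 'M[R]_k) i j m :
  `|phi_entry_coef B i j m| <= 1 * (mxl1 B ^+ m / m`!%:R).
Proof.
rewrite mul1r normrM mulrC ler_pM//; first exact: expr_entry_le.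
by rewrite ger0_norm ?invr_ge0// inv_fact_le.
Qed.

(** Convergence of the matrix series holds since it holds in each entry, where the
    exponential series of the norm is a majorant. *)
Lemma phi_mx_entry k (B : 'M[R]_k) s i j :
  phi_mx (s *: B) i j = limn (pseries (phi_entry_coef B i j) s).
Proof.
pose L := \matrix_(i, j) limn (pseries (phi_entry_coef B i j) s).
suff phiL : phi_mx (s *: B) = L by rewrite phiL mxE.
apply/cvg_lim; first exact: norm_hausdorff.
apply: cvg_mx => {}i {}j; rewrite mxE.
rewrite (_ : (fun _ => _) = pseries (phi_entry_coef B i j) s).
  by have [] := pseries_exp_dominated s (mxl1_ge0 B) (phi_entry_coef_le B i j).
apply/funext => N; rewrite /pseries /series/= summxE; apply: eq_bigr => m _.
by rewrite !mxE exprZ_mx mxE /phi_entry_coef mulrCA mulrC.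
Qed.

Lemma phi_mx_entry_le k (B : 'M[R]_k) s i j :
  `|phi_mx (s *: B) i j| <= expR (mxl1 B * `|s|).
Proof.
rewrite phi_mx_entry -[leRHS]mul1r.
by have [] := pseries_exp_dominated s (mxl1_ge0 B) (phi_entry_coef_le B i j).
Qed.

(** The integral of exp (u B) for [u] between 0 and [s]. *)
Definition int_exp k (B : 'M[R]_k) s : 'M[R]_k := s *: phi_mx (s *: B).

(** The power series of the entries of [int_exp B] is that of [phi_mx] shifted by
    one degree, because of the factor [s]. *)
Definition int_exp_coef k (B : 'M[R]_k) i j m : R :=
  if m is m'.+1 then phi_entry_coef B i j m' else 0.

(** The base is [1 + mxl1 B] because the shift in degree costs one factor, which
    must be at least 1. *)
Lemma int_exp_coef_le k (B : 'M[R]_k) i j m :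
  `|int_exp_coef B i j m| <= 1 * ((1 + mxl1 B) ^+ m / m`!%:R).
Proof.
have B0 := mxl1_ge0 B; rewrite mul1r.
case: m => [|m] /=; first by rewrite normr0 expr0 divr1.
rewrite normrM mulrC ler_pM//.
  rewrite (le_trans (expr_entry_le _ _ _ _))// exprS.
  rewrite -[leLHS]mul1r ler_pM ?exprn_ge0 ?lerDl// lerXn2r ?nnegrE ?addr_ge0//.
  by rewrite lerDr.
by rewrite ger0_norm ?invr_ge0.
Qed.

Lemma diffs_int_exp_coef k (B : 'M[R]_k) i j m :
  pseries_diffs (int_exp_coef B i j) m = (B ^+ m) i j / m`!%:R.
Proof.
rewrite /pseries_diffs/= /phi_entry_coef /phi_coef factS natrM invfM.
by rewrite !mulrA divff ?mul1r 1?mulrC// pnatr_eq0.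
Qed.

Lemma int_exp_entry k (B : 'M[R]_k) s i j :
  int_exp B s i j = limn (pseries (int_exp_coef B i j) s).
Proof.
rewrite mxE phi_mx_entry; apply/esym/cvg_lim => //.
have [c _] := pseries_exp_dominated s (mxl1_ge0 B) (phi_entry_coef_le B i j).
rewrite -cvg_shiftS.
rewrite (_ : (fun _ => _) = (fun N => s * pseries (phi_entry_coef B i j) s N)).
  exact: cvgMl_tmp.
apply/funext => N; rewrite /pseries /series/= big_nat_recl//= mul0r add0r.
by rewrite big_distrr; apply: eq_bigr => m _ /=; rewrite exprS mulrCA.
Qed.

(** Differentiating the entries of the series term by term gives the series of
    exp (s B). Its term of degree 0 is the identity, and pulling one factor [B] out
    of the others gives back [B *m int_exp B s]. *)
Lemma is_derive_int_exp k (B : 'M[R]_k) s :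
  is_derive s (1 : R) (int_exp B) (1%:M + B *m int_exp B s).
Proof.
have b0 : 0 <= 1 + mxl1 B by rewrite addr_ge0 ?mxl1_ge0.
apply/is_derive_mxP => i j.
rewrite (_ : (fun _ => _) =
    (fun x => limn (pseries (int_exp_coef B i j) x))); last first.
  by apply/funext => x; exact: int_exp_entry.
have c0 x l := (pseries_exp_dominated x b0 (int_exp_coef_le B l j)).1.
have d1 m : `|pseries_diffs (int_exp_coef B i j) m| <=
    1 * (mxl1 B ^+ m / m`!%:R).
  rewrite mul1r diffs_int_exp_coef normrM ler_pM//; first exact: expr_entry_le.
  by rewrite ger0_norm ?invr_ge0.
have c1 x := (pseries_exp_dominated x (mxl1_ge0 B) d1).1.
have d2 m : `|pseries_diffs (pseries_diffs (int_exp_coef B i j)) m| <=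
    mxl1 B * (mxl1 B ^+ m / m`!%:R).
  rewrite {1}/pseries_diffs diffs_int_exp_coef factS natrM invfM.
  rewrite mulrCA (mulrA m.+1%:R) divff ?pnatr_eq0// mul1r normrM.
  rewrite mulrA -exprS ler_pM//; first exact: expr_entry_le.
  by rewrite ger0_norm ?invr_ge0.
have c2 x := (pseries_exp_dominated x (mxl1_ge0 B) d2).1.
(* Any point of modulus greater than that of [s] serves: all radii are infinite. *)
have := pseries_snd_diffs (c0 (`|s| + 1) i) (c1 (`|s| + 1)) (c2 (`|s| + 1)).
move=> /(_ s); have -> : `|s| < `|(`|s| + 1)|.
  by rewrite [ltRHS]ger0_norm ?addr_ge0// ltrDl.
move=> /(_ isT) H; apply: (is_derive_eq H) => {H}.
apply/cvg_lim => //; rewrite -cvg_shiftS !mxE.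
rewrite (_ : (fun _ => _) = (fun N => (i == j)%:R +
   \sum_l B i l * pseries (int_exp_coef B l j) s N.+1)).
  apply: cvgD; first exact: cvg_cst.
  apply: cvg_big => [|l _]; first exact: add_continuous.
  apply: cvgMl_tmp; rewrite int_exp_entry.
  by have := c0 s l; rewrite -cvg_shiftS.
apply/funext => N; rewrite /pseries /series/= big_nat_recl//=.
rewrite diffs_int_exp_coef !expr0 mxE divr1 mulr1; congr (_ + _).
under [RHS]eq_bigr do rewrite big_nat_recl//= mul0r add0r big_distrr/=.
rewrite exchange_big/=; apply: eq_bigr => m _.
rewrite diffs_int_exp_coef [B ^+ _]exprS mxE 2!big_distrl/=.
by apply: eq_bigr => l _; rewrite /phi_entry_coef /phi_coef; ring.
Qed.

End PhiFunction.

(** * The Krylov approximation and its residual *)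

Section Krylov.
Set Implicit Arguments.
Unset Strict Implicit.
Context {R : realType} {n : nat}.
Implicit Types (A : 'M[R]_n) (g v b : 'cV[R]_n) (k : nat).

Definition first_unit k : 'cV[R]_k := \col_i ((i : nat) == 0%N)%:R.

Lemma krylov_approxE A g v k :
  krylov_approx A g v k = fun s =>
    v + arnoldi_V A (g - A *m v) k *m int_exp (- arnoldi_H A (g - A *m v) k) s
        *m (norm2 (g - A *m v) *: first_unit k).
Proof.
apply/funext => s.
by rewrite /krylov_approx /int_exp scalerN -scaleNr -mulmxA -[in RHS]scalemxAl.
Qed.

(** A column of [arnoldi_V] is a normalised vector, or zero at a breakdown. *)
Lemma arnoldi_V_entry_le A b k i j : `|arnoldi_V A b k i j| <= 1.
Proof.
have unit_entry (w : 'cV[R]_n) l : `|((norm2 w)^-1 *: w) l 0| <= 1.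
  rewrite mxE normrM normfV (ger0_norm (norm2_ge0 w)).
  have [->|w0] := eqVneq (norm2 w) 0; first by rewrite invr0 mul0r.
  by rewrite mulrC ler_pdivrMr ?lt0r ?w0 ?norm2_ge0// mul1r coord_le_norm2.
rewrite mxE; case: (j : nat) => [|m] /=; first exact: unit_entry.
by rewrite last_rcons; exact: unit_entry.
Qed.

Lemma arnoldi_V_first_unit A b k : (0 < k)%N ->
  arnoldi_V A b k *m (norm2 b *: first_unit k) = b.
Proof.
case: k => // k _; rewrite -scalemxAr; apply/colP => i.
rewrite !mxE big_ord_recl !mxE/= mulr1 big1 => [|l _]; last first.
  by rewrite !mxE /= mulr0.
rewrite addr0; have [b0|b0] := eqVneq (norm2 b) 0.
  by rewrite (norm2_eq0 b0) mxE !mulr0.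
by rewrite mulrA divff// mul1r.
Qed.

Lemma is_derive_krylov A g v k s :
  is_derive s (1 : R) (krylov_approx A g v k)
    (arnoldi_V A (g - A *m v) k *m
     (1%:M - arnoldi_H A (g - A *m v) k *m
       int_exp (- arnoldi_H A (g - A *m v) k) s)
     *m (norm2 (g - A *m v) *: first_unit k)).
Proof.
rewrite krylov_approxE -[X in is_derive _ _ _ X]add0r.
apply: (@is_deriveD _ _ _ (cst v)); apply: is_derive_sandwich.
rewrite -(mulNmx (arnoldi_H _ _ _)).
exact: is_derive_int_exp.
Qed.

(** By the equation for the derivative of [int_exp], the residual is
    b - V (norm2 b e1) + (V H - A V) E(s) (norm2 b e1), and the first two terms
    cancel. *)
Lemma residualE A g v k s : (0 < k)%N ->
  residual A g (krylov_approx A g v k) s =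
  (arnoldi_V A (g - A *m v) k *m arnoldi_H A (g - A *m v) k
    - A *m arnoldi_V A (g - A *m v) k)
  *m int_exp (- arnoldi_H A (g - A *m v) k) s
  *m (norm2 (g - A *m v) *: first_unit k).
Proof.
move=> k0; rewrite /residual derive1E.
have [_ ->] := is_derive_krylov A g v k s.
rewrite krylov_approxE mulmxBr mulmx1 !mulmxBl arnoldi_V_first_unit//.
rewrite mulmxDr !mulmxA.
move: (_ *m _ *m _ *m _) (_ *m _ *m _ *m _) => X Y.
apply/colP => i; rewrite !mxE; ring.
Qed.

Lemma continuous_residual A g v k : (0 < k)%N ->
  continuous (residual A g (krylov_approx A g v k)).
Proof.
move=> k0 s; rewrite (funext (fun s => residualE A g v s k0)).
apply: is_derive_continuous; apply: is_derive_sandwich; exact: is_derive_int_exp.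
Qed.

(** The constant is the product of bounds for the factors of the residual other
    than [s]. It is uniform in [v] because the Arnoldi matrices enter only through
    the bound on their entries, and the initial residual through [K]. *)
Lemma residual_linear_bound A g k (K t : R) : (0 < k)%N -> 0 <= t ->
  exists2 C, 0 < C & forall v s, norm2 v <= K -> 0 <= s <= t ->
    norm2 (residual A g (krylov_approx A g v k) s) <= C * s.
Proof.
move=> k0 t0.
(* Bounds for V, H, V H - A V, phi(-s H) and norm2 b e1, in this order. *)
pose V1 : R := (n * k)%:R * 1.
pose H1 := V1 * mxl1 A * V1.
pose P1 := V1 * H1 + mxl1 A * V1.
pose F1 := (k * k)%:R * expR (H1 * t).
pose x1 := (norm2 g + mxl1 A * ((n * 1)%:R * K)) * ((k * 1)%:R * 1).
(* Positive whatever the sign of [K]. *)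
exists (1 + `|P1 * F1 * x1|) => [|v s vK st].
  by rewrite ltr_pwDl.
rewrite residualE//.
set b := g - A *m v; set V := arnoldi_V A b k; set H := arnoldi_H A b k.
have V0 : 0 <= V1 by rewrite /V1 mulr_ge0.
have A0 := mxl1_ge0 A.
have VV : mxl1 V <= V1 by apply: mxl1_bound => i j; exact: arnoldi_V_entry_le.
have HH : mxl1 H <= H1.
  rewrite (le_trans (mxl1M _ _))// ler_pM ?mxl1_ge0//.
  rewrite (le_trans (mxl1M _ _))// ler_pM ?mxl1_ge0//.
  by rewrite mxl1_tr.
have H0 : 0 <= H1 by rewrite !mulr_ge0.
have PP : mxl1 (V *m H - A *m V) <= P1.
  rewrite (le_trans (mxl1D _ _))// mxl1N lerD// (le_trans (mxl1M _ _))//.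
    by rewrite ler_pM ?mxl1_ge0.
  by rewrite ler_wpM2l.
have P0 : 0 <= P1 by rewrite addr_ge0 ?mulr_ge0.
have FF : mxl1 (phi_mx (s *: (- H))) <= F1.
  apply: mxl1_bound => i j; rewrite (le_trans (phi_mx_entry_le _ _ _ _))//.
  move/andP: st => [s0 st].
  by rewrite ler_expR mxl1N ger0_norm// ler_pM ?mxl1_ge0.
have F0 : 0 <= F1 by rewrite mulr_ge0// expR_ge0.
have xx : mxl1 (norm2 b *: first_unit k) <= x1.
  rewrite mxl1Z ger0_norm ?norm2_ge0// ler_pM ?norm2_ge0 ?mxl1_ge0//.
    rewrite (le_trans (ler_norm2D _ _))// norm2N lerD2l.
    rewrite (le_trans (norm2_le_mxl1 _))// (le_trans (mxl1M _ _))// ler_wpM2l//.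
    apply: mxl1_bound => i j; rewrite (ord1 j).
    exact: le_trans (coord_le_norm2 _ _) vK.
  apply: mxl1_bound => i j; rewrite mxE.
  by case: eqP; rewrite ?normr1 ?normr0.
rewrite (le_trans (norm2_le_mxl1 _))//.
rewrite /int_exp -(scalemxAr s) -(scalemxAl s) mxl1Z.
move/andP: st => [s0 _].
rewrite ger0_norm// mulrC ler_wpM2r//.
rewrite (@le_trans _ _ (P1 * F1 * x1))//.
  rewrite (le_trans (mxl1M _ _))// ler_pM ?mxl1_ge0//.
  by rewrite (le_trans (mxl1M _ _))// ler_pM ?mxl1_ge0.
by rewrite (le_trans (ler_norm _))// lerDr.
Qed.

(** The supremum of the admissible lengths is admissible, as the set where [f] is
    at most [c] is closed. *)
Lemma exists_largest_le (f : R -> R) (d0 tau c : R) :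
  continuous f -> 0 <= d0 <= tau -> (forall s, 0 <= s <= d0 -> f s <= c) ->
  exists d, [/\ d0 <= d <= tau, forall s, 0 <= s <= d -> f s <= c &
    forall d', 0 <= d' <= tau ->
      (forall s, 0 <= s <= d' -> f s <= c) -> d' <= d].
Proof.
move=> fc /andP[d00 d0tau] fd0.
pose E : set R := [set d | 0 <= d <= tau /\ forall s, 0 <= s <= d -> f s <= c].
have Ed0 : E d0 by split => //; rewrite d00.
have ubE : ubound E tau by move=> d [/andP[]].
have supE : has_sup E by split; [exists d0|exists tau].
exists (sup E); split => [|s /andP[s0 sE]|d' d'tau fd'].
- by rewrite ge_sup ?andbT//; [apply: ub_le_sup => //; exists tau|exists d0].
- rewrite leNgt; apply/negP => cfs.
  have [e /= e0 fe] : \forall x \near s, c < f x by exact: (cvgr_gt _ (fc s) _ cfs).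
  have [d [dtau fd] dE] := sup_adherent e0 supE.
  have [sd|ds] := leP s d.
    by have := fd _ (introT andP (conj s0 sd)); rewrite leNgt cfs.
  have cfd : c < f d by apply: fe; rewrite /= gtr0_norm ?subr_gt0//; lra.
  have : f d <= c by apply: fd; rewrite lexx andbT; case/andP: dtau.
  by rewrite leNgt cfd.
- by apply: ub_le_sup => //; exists tau.
Qed.

End Krylov.

(** * The cycles of the restarted method *)

Section Restarts.
Set Implicit Arguments.
Unset Strict Implicit.
Context {R : realType} {n : nat}.
Context (A : 'M[R]_n) (g : 'cV[R]_n) (tol : R).
Context (hA : accretive A) (tol0 : 0 < tol).

Lemma is_derive_krylov_residual v k s :
  is_derive s (1 : R) (krylov_approx A g v k)
    (- (A *m krylov_approx A g v k s) + g
     - residual A g (krylov_approx A g v k) s).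
Proof.
have H := is_derive_krylov A g v k s; apply: (is_derive_eq H).
rewrite /residual derive1E; have [_ ->] := H.
by rewrite opprD opprK addrA subrr add0r.
Qed.

Lemma krylov_approx0 v k : krylov_approx A g v k 0 = v.
Proof. by rewrite /krylov_approx scale0r mulmx0 addr0. Qed.

(** A priori bound: in the equation for the Krylov approximation the forcing term
    is [g] minus the residual. *)
Lemma norm2_krylov_le v k d : 0 <= d -> residual_le A g tol v k d ->
  norm2 (krylov_approx A g v k d) <= norm2 v + d * (norm2 g + tol).
Proof.
move=> d0 rd.
have := @accretive_growth_le _ _ A (krylov_approx A g v k)
  (fun s => g - residual A g (krylov_approx A g v k) s) 0 d (norm2 g + tol).
rewrite krylov_approx0 subr0; apply => //.
- apply: continuous_subspaceT => s; apply: is_derive_continuous.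
  exact: is_derive_krylov.
- by move=> s _; rewrite addrA; exact: is_derive_krylov_residual.
- move=> s /andP[s0 sd]; rewrite (le_trans (ler_norm2D _ _))// norm2N lerD2l.
  by apply: rd; rewrite !ltW.
Qed.

(** The initial value of [y] may differ from [v]: in later cycles the difference
    is the error accumulated so far. *)
Lemma krylov_error_le (y : R -> 'cV[R]_n) v k a d :
  0 <= d -> residual_le A g tol v k d ->
  {within `[a, a + d], continuous y} ->
  (forall s, a < s < a + d -> is_derive s (1 : R) y (- (A *m y s) + g)) ->
  norm2 (y (a + d) - krylov_approx A g v k d) <= norm2 (y a - v) + d * tol.
Proof.
move=> d0 rd yc dy; pose K s := krylov_approx A g v k (s - a).
have dK s := @is_derive_translate _ _ _ _ a s _
  (is_derive_krylov_residual v k (s - a)).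
have := @accretive_growth_le _ _ A (y - K)
  (fun s => residual A g (krylov_approx A g v k) (s - a)) a (a + d) tol hA.
rewrite !fctE /K subrr krylov_approx0 [a + d - a]addrAC subrr add0r; apply => //.
- by rewrite lerDl.
- apply: within_continuousB => //.
  by apply: continuous_subspaceT => s; apply: is_derive_continuous; exact: dK.
- move=> s sad; have dys := dy s sad.
  apply: (is_derive_eq (is_deriveB dys (dK s))).
  rewrite mulmxBr; move: (A *m _) (A *m _) (residual _ _ _ _) => X Y Z.
  by apply/colP => i; rewrite !mxE; ring.
- by move=> s /andP[sa sd]; apply: rd; lra.
Qed.

(** The starting time [a] of a cycle varies, while the solution [y] remains the
    one on the whole interval. *)
Lemma rt_run_error_le (y : R -> 'cV[R]_n) (kmax : nat) v tau J yout a :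
  rt_run A g tol kmax v tau J yout -> 0 <= tau ->
  {within `[a, a + tau], continuous y} ->
  (forall s, a < s < a + tau -> is_derive s (1 : R) y (- (A *m y s) + g)) ->
  norm2 (y (a + tau) - yout) <= norm2 (y a - v) + tau * tol.
Proof.
move=> run; elim: run a => {v tau J yout}.
(* A stop at [v] means a stationary point, whose constant solution has residual 0. *)
- move=> v tau /norm2_eq0 /eqP; rewrite subr_eq0 => /eqP gE a tau0 yc dy.
  have := @accretive_growth_le _ _ A (y - cst v) (cst 0) a (a + tau) tol hA.
  rewrite !fctE [a + tau - a]addrAC subrr add0r; apply => //.
  + by rewrite lerDl.
  + apply: within_continuousB => //.
    by apply: continuous_subspaceT => s; exact: cst_continuous.
  + move=> s sad; have dys := dy s sad.
    apply: (is_derive_eq (is_deriveB dys (is_derive_cst v s 1))).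
    by rewrite subr0 addr0 mulmxBr opprB -gE addrC.
  + by move=> s _; rewrite norm20 ltW.
- by move=> v tau k _ _ rd _ a tau0 yc dy; exact: krylov_error_le.
- move=> v tau d J yout _ _ /andP[d0 dtau] rd _ _ IH a tau0 yc dy.
  have E : a + tau = a + d + (tau - d) by ring.
  rewrite E (le_trans (IH (a + d) _ _ _))//.
  + by rewrite subr_ge0.
  + rewrite -E; apply: continuous_subspaceW yc.
    by apply: subset_itvr; rewrite bnd_simp lerDl.
  + by rewrite -E => s /andP[s1 s2]; apply: dy; lra.
  have := @krylov_error_le y v kmax a d d0 rd.
  have yc' : {within `[a, a + d], continuous y}.
    apply: continuous_subspaceW yc.
    by apply: subset_itvl; rewrite bnd_simp lerD2l.
  move=> /(_ yc').
  have dy' s : a < s < a + d ->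
      is_derive s (1 : R) y (- (A *m y s) + g).
    by move=> /andP[s1 s2]; apply: dy; lra.
  move=> /(_ dy'); lra.
Qed.

(** If the cycle does not stop, then [h < tau], so [h] is one of the lengths over
    which the restart time is the largest. *)
Lemma rt_stop_or_restart (kmax : nat) v tau h :
  (0 < kmax)%N -> 0 <= tau -> 0 < h ->
  (forall d, 0 <= d <= tau -> d <= h -> residual_le A g tol v kmax d) ->
  (exists yout, rt_run A g tol kmax v tau 0 yout) \/
  exists d, [/\ h <= d <= tau, residual_le A g tol v kmax d &
    forall J yout,
      rt_run A g tol kmax (krylov_approx A g v kmax d) (tau - d) J yout ->
      rt_run A g tol kmax v tau J.+1 yout].
Proof.
move=> kmax0 tau0 h0 small.
have [b0|/eqP b0] := eqVneq (norm2 (g - A *m v)) 0.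
  by left; exists v; exact: rt_exact.
pose stops k := `[< (1 <= k <= kmax)%N /\ residual_le A g tol v k tau >].
have [[k kstops]|nostop] := pselect (exists k, stops k).
  have ex : exists k, stops k by exists k.
  left; case: (ex_minnP ex) => {k kstops} k /asboolP[kk rk] kmin.
  exists (krylov_approx A g v k tau).
  apply: rt_stop => // j /andP[j1 jk] rj.
  have /kmin : stops j.
    by apply/asboolP; split => //; rewrite j1 (leq_trans (ltnW jk))//; case/andP: kk.
  by rewrite leqNgt jk.
have nstop k : (1 <= k <= kmax)%N -> ~ residual_le A g tol v k tau.
  by move=> kk rk; apply: nostop; exists k; apply/asboolP.
have htau : h <= tau.
  rewrite leNgt; apply/negP => tauh; apply: (nstop kmax); first by rewrite kmax0 /=.
  by apply: small; [rewrite tau0 /=|exact: ltW].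
have fc : continuous (fun s => norm2 (residual A g (krylov_approx A g v kmax) s)).
  move=> s; apply: (@continuous_comp _ _ _
    (residual A g (krylov_approx A g v kmax)) (@norm2 R n));
    last exact: continuous_norm2.
  exact: continuous_residual.
have hd : 0 <= h <= tau by rewrite ltW.
have [d [dd rd dmax]] := exists_largest_le fc hd (small h hd (lexx h)).
right; exists d; split => // J yout.
apply: rt_restart => //.
by case/andP: dd => hd' ->; rewrite (le_trans (ltW h0)).
Qed.

(** Induction on the number of time steps of length [h = tol / C] that cover the
    remaining time, for all restart vectors that respect the a priori bound; the
    latter leaves room for the growth over the remaining time, and so is inherited
    by the next cycle. *)
Lemma rt_run_exists (kmax : nat) v t : (0 < kmax)%N -> 0 <= t ->
  exists J yout, rt_run A g tol kmax v t J yout.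
Proof.
move=> kmax0 t0.
pose G := norm2 g + tol.
have G0 : 0 < G by rewrite ltr_wpDl ?norm2_ge0.
have [C C0 rC] := residual_linear_bound A g (norm2 v + t * G) kmax0 t0.
pose h := tol / C.
have h0 : 0 < h by rewrite divr_gt0.
suff steps m : forall w tau, 0 <= tau <= t -> tau <= m%:R * h ->
    norm2 w + tau * G <= norm2 v + t * G ->
    exists J yout, rt_run A g tol kmax w tau J yout.
  apply: (steps (Num.truncn (t / h)).+1); rewrite ?lexx ?t0//.
  by rewrite -ler_pdivrMr// ltW// Num.Theory.truncnS_gt.
elim: m => [|m IH] w tau /andP[tau0 taut] taum wtau.
all: have wK : norm2 w <= norm2 v + t * G
    by apply: le_trans wtau; rewrite lerDl mulr_ge0// ltW.
all: have small d : 0 <= d <= tau -> d <= h -> residual_le A g tol w kmax d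
    by move=> /andP[d0 dt] dh s /andP[s0 sd];
       rewrite (le_trans (rC w s wK _)) ?s0 ?(le_trans sd)//=
         ?(le_trans dt)// mulrC -ler_pdivlMr// (le_trans sd).
all: have [[yout run]|[d [/andP[hd dtau] rd restart]]] :=
    rt_stop_or_restart kmax0 tau0 h0 small; first by exists 0%N, yout.
  (* No time remains, so there is no room for a restart. *)
  by move: taum; rewrite mul0r => taum; lra.
have d0 : 0 <= d by rewrite (le_trans _ hd)// ltW.
have := norm2_krylov_le d0 rd => kw.
have [|||J [yout run]] := IH (krylov_approx A g w kmax d) (tau - d).
- by rewrite subr_ge0 dtau/=; lra.
- by move: taum; rewrite -natr1 mulrDl mul1r; lra.
- move: kw wtau; rewrite -/G; lra.
by exists J.+1, yout; exact: restart.
Qed.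

End Restarts.

Theorem proposition5p1 (R : realType) (n : nat) (A : 'M[R]_n)
    (g v : 'cV[R]_n) (t tol : R) (kmax : nat)
    (hA : accretive A) (hg : g != 0) (ht : 0 < t) (htol : 0 < tol)
    (hkmax : (1 <= kmax)%N) :
  (exists (J : nat) (yout : 'cV[R]_n), rt_run A g tol kmax v t J yout) /\
  (forall (y : R -> 'cV[R]_n) (J : nat) (yout : 'cV[R]_n),
     ivp_solution A g v t y -> rt_run A g tol kmax v t J yout ->
     norm2 (y t - yout) <= t * tol).
Proof.
split; first exact: rt_run_exists (ltW ht).
move=> y J yout [y0 yc dy] run.
have := @rt_run_error_le _ _ A g tol hA htol y kmax v t J yout 0 run (ltW ht).
by rewrite !add0r y0 subrr norm20 add0r; apply.
Qed.
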